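(* Let $K$ be a field, let $\phi:\mathfrak g\to\mathfrak h$ be a homomorphism of Lie algebras over $K$ with $\operatorname{cd}(\phi)=n$ (an integer $n\ge 0$), let $(P_*(\mathfrak g),\partial_* )$ be a projective resolution of the trivial $U(\mathfrak g)$-module $K$, let $(P_*(\mathfrak h),\partial'_* )$ be a projective resolution of the trivial $U(\mathfrak h)$-module $K$, and let $\phi_*:(P_*(\mathfrak g),\partial_* )\to(P_*(\mathfrak h),\partial'_* )$ be the chain map induced by $\phi$. Then $\phi_*$ is chain homotopic to a chain map $\psi_*:P_*(\mathfrak g)\to P_*(\mathfrak h)$ such that $\psi_i=0$ for all $i>n$.
   Context: Lie algebras are over a field $K$ and may be infinite-dimensional. Modules over a Lie algebra $\mathfrak g$ are left $\mathfrak g$-modules, equivalently left modules over the universal enveloping algebra $U(\mathfrak g)$ (no finiteness assumption). $H^n(\mathfrak g,M)$ denotes Chevalley--Eilenberg cohomology (equivalently $\operatorname{Ext}^n_{U(\mathfrak g)}(K,M)$). For a Lie algebra homomorphism $\phi:\mathfrak g\to\mathfrak h$ and an $\mathfrak h$-module $M$, regarded as a $\mathfrak g$-module by restriction along $\phi$, there is an induced map $\phi^*:H^n(\mathfrak h,M)\to H^n(\mathfrak g,M)$ for each $n\ge 0$. The cohomological dimension of $\phi$ is $$\operatorname{cd}(\phi)=\sup\{n\ge 0:\ \text{there is an }\mathfrak h\text{-module }M\text{ with }\phi^*:H^n(\mathfrak h,M)\to H^n(\mathfrak g,M)\text{ nonzero}\}.$$ In the claim, $U(\mathfrak h)$-modules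 are regarded as $U(\mathfrak g)$-modules via the algebra homomorphism $U(\phi):U(\mathfrak g)\to U(\mathfrak h)$ induced by $\phi$. Chain maps $P_*(\mathfrak g)\to P_*(\mathfrak h)$ and chain homotopies between them are $U(\mathfrak g)$-linear. The chain map induced by $\phi$ is a $U(\mathfrak g)$-linear chain map lifting $\operatorname{id}_K$; it is unique up to chain homotopy. *)

(* Defs.v *)
From HB Require Import structures.
From mathcomp Require Import all_boot all_algebra.
From mathcomp Require Import boolp.

Set Implicit Arguments.
Unset Strict Implicit.
Unset Printing Implicit Defensive.

Import GRing.Theory.
Local Open Scope ring_scope.
Local Open Scope quotient_scope.

HB.mixin Record Lmodule_isLie (K : fieldType) L of GRing.Lmodule K L := {
  bracket : L -> L -> L;
  bracketDl : forall (a : K) (x y z : L),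
    bracket (a *: x + y) z = a *: bracket x z + bracket y z;
  bracketDr : forall (a : K) (x y z : L),
    bracket z (a *: x + y) = a *: bracket z x + bracket z y;
  bracketxx : forall x : L, bracket x x = 0;
  jacobi : forall x y z : L,
    bracket x (bracket y z) + bracket y (bracket z x)
      + bracket z (bracket x y) = 0
}.

#[short(type="lieAlgType")]
HB.structure Definition LieAlgebra (K : fieldType) :=
  {L of Lmodule_isLie K L & GRing.Lmodule K L}.

Record lie_hom (K : fieldType) (g h : lieAlgType K) := LieHom {
  lie_fun :> {linear g -> h};
  lie_hom_bracket : forall x y : g,
    lie_fun (bracket x y) = bracket (lie_fun x) (lie_fun y)
}.

(** [uea g] is the universal enveloping algebra of [g], as the associative unital
    K-algebra with generators [g] (linearly) and relations xy - yx = [x, y].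
    [uea_lift_gen] and [uea_lift_uniq] are its universal property. *)

Section Terms.
Variables (K : fieldType) (g : lieAlgType K).

Inductive uterm : Type :=
| UGen of g
| UScal of K
| UAdd of uterm & uterm
| UMul of uterm & uterm.

Inductive ueq : uterm -> uterm -> Prop :=
| ueq_refl t : ueq t t
| ueq_sym t u : ueq t u -> ueq u t
| ueq_trans t u v : ueq t u -> ueq u v -> ueq t v
| ueq_add t t' u u' : ueq t t' -> ueq u u' -> ueq (UAdd t u) (UAdd t' u')
| ueq_mul t t' u u' : ueq t t' -> ueq u u' -> ueq (UMul t u) (UMul t' u')
| ueq_addA t u v : ueq (UAdd t (UAdd u v)) (UAdd (UAdd t u) v)
| ueq_addC t u : ueq (UAdd t u) (UAdd u t)
| ueq_add0 t : ueq (UAdd (UScal 0) t) t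
| ueq_addN t : ueq (UAdd (UMul (UScal (-1)) t) t) (UScal 0)
| ueq_mulA t u v : ueq (UMul t (UMul u v)) (UMul (UMul t u) v)
| ueq_mul1l t : ueq (UMul (UScal 1) t) t
| ueq_mulDl t u v : ueq (UMul (UAdd t u) v) (UAdd (UMul t v) (UMul u v))
| ueq_mulDr t u v : ueq (UMul t (UAdd u v)) (UAdd (UMul t u) (UMul t v))
| ueq_scalD a b : ueq (UScal (a + b)) (UAdd (UScal a) (UScal b))
| ueq_scalM a b : ueq (UScal (a * b)) (UMul (UScal a) (UScal b))
| ueq_scalC a t : ueq (UMul (UScal a) t) (UMul t (UScal a))
| ueq_genD x y : ueq (UGen (x + y)) (UAdd (UGen x) (UGen y))
| ueq_genZ a x : ueq (UGen (a *: x)) (UMul (UScal a) (UGen x))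
| ueq_genB x y :
    ueq (UMul (UGen x) (UGen y))
        (UAdd (UMul (UGen y) (UGen x)) (UGen (bracket x y))).

HB.instance Definition _ := gen_eqMixin uterm.
HB.instance Definition _ := gen_choiceMixin uterm.

Definition ueqb (t u : uterm) : bool := `[< ueq t u >].

Lemma ueqb_equiv : equiv_class_of ueqb.
Proof.
split=> [t | t u | u t v].
- exact/asboolP/ueq_refl.
- by apply/asboolP/asboolP; exact: ueq_sym.
- by move=> /asboolP tu /asboolP uv; apply/asboolP; exact: ueq_trans tu uv.
Qed.

Canonical ueqb_equivRel := EquivRelPack ueqb_equiv.

Definition uea := {eq_quot ueqb}.
HB.instance Definition _ := Choice.on uea.
HB.instance Definition _ := EqQuotient.on uea.

Implicit Types (t u : uterm) (x y z : uea).

Lemma uea_eqP t u : (\pi_uea t = \pi_uea u) <-> ueq t u.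
Proof.
by split=> [/(@eqmodP _ ueqb_equivRel _ _)/asboolP | tu];
   last exact/(@eqmodP _ ueqb_equivRel _ _)/asboolP.
Qed.

Definition uea_scal (a : K) : uea := \pi_uea (UScal a).
Definition uea_add x y : uea := \pi_uea (UAdd (repr x) (repr y)).
Definition uea_mul x y : uea := \pi_uea (UMul (repr x) (repr y)).
Definition uea_opp x := uea_mul (uea_scal (-1)) x.

Lemma ueq_repr t : ueq (repr (\pi_uea t)) t.
Proof. by apply/uea_eqP; rewrite reprK. Qed.

Lemma pi_uadd t u : \pi_uea (UAdd t u) = uea_add (\pi_uea t) (\pi_uea u).
Proof. by apply/uea_eqP; apply: ueq_add; apply: ueq_sym; exact: ueq_repr. Qed.

Lemma pi_umul t u : \pi_uea (UMul t u) = uea_mul (\pi_uea t) (\pi_uea u).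
Proof. by apply/uea_eqP; apply: ueq_mul; apply: ueq_sym; exact: ueq_repr. Qed.

Lemma uea_addA : associative uea_add.
Proof.
elim/quotW=> t; elim/quotW=> u; elim/quotW=> v.
rewrite -(pi_uadd u v) -(pi_uadd t u) -(pi_uadd t) -(pi_uadd _ v).
by apply/uea_eqP; constructor.
Qed.

Lemma uea_addC : commutative uea_add.
Proof.
elim/quotW=> t; elim/quotW=> u; rewrite -(pi_uadd t u) -(pi_uadd u t).
by apply/uea_eqP; constructor.
Qed.

Lemma uea_add0 : left_id (uea_scal 0) uea_add.
Proof.
by elim/quotW=> t; rewrite -(pi_uadd (UScal 0) t); apply/uea_eqP; constructor.
Qed.

Lemma uea_addN : left_inverse (uea_scal 0) uea_opp uea_add.
Proof.
elim/quotW=> t; rewrite /uea_opp -(pi_umul (UScal (-1)) t) -(pi_uadd _ t).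
by apply/uea_eqP; constructor.
Qed.

HB.instance Definition _ :=
  GRing.isZmodule.Build uea uea_addA uea_addC uea_add0 uea_addN.

Lemma uea_mulA : associative uea_mul.
Proof.
elim/quotW=> t; elim/quotW=> u; elim/quotW=> v.
rewrite -(pi_umul u v) -(pi_umul t u) -(pi_umul t) -(pi_umul _ v).
by apply/uea_eqP; constructor.
Qed.

Lemma uea_scalC a x : uea_mul (uea_scal a) x = uea_mul x (uea_scal a).
Proof.
elim/quotW: x => t.
rewrite -(pi_umul (UScal a) t) -(pi_umul t (UScal a)).
by apply/uea_eqP; constructor.
Qed.

Lemma uea_mul1l : left_id (uea_scal 1) uea_mul.
Proof.
by elim/quotW=> t; rewrite -(pi_umul (UScal 1) t); apply/uea_eqP; constructor.
Qed.

Lemma uea_mul1r : right_id (uea_scal 1) uea_mul.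
Proof. by move=> x; rewrite -uea_scalC uea_mul1l. Qed.

Lemma uea_mulDl : left_distributive uea_mul +%R.
Proof.
elim/quotW=> t; elim/quotW=> u; elim/quotW=> v.
rewrite -[X in uea_mul X](pi_uadd t u) -(pi_umul _ v) -(pi_umul t v) -(pi_umul u v).
rewrite -[RHS](pi_uadd (UMul t v) (UMul u v)).
by apply/uea_eqP; constructor.
Qed.

Lemma uea_mulDr : right_distributive uea_mul +%R.
Proof.
elim/quotW=> t; elim/quotW=> u; elim/quotW=> v.
rewrite -[X in uea_mul _ X](pi_uadd u v) -(pi_umul t) -(pi_umul t u) -(pi_umul t v).
rewrite -[RHS](pi_uadd (UMul t u) (UMul t v)).
by apply/uea_eqP; constructor.
Qed.

Lemma uea_scalD : {morph uea_scal : a b / a + b}.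
Proof.
move=> a b; rewrite -[RHS](pi_uadd (UScal a) (UScal b)).
by apply/uea_eqP; constructor.
Qed.

Lemma uea_scalM a b : uea_scal (a * b) = uea_mul (uea_scal a) (uea_scal b).
Proof.
by rewrite -(pi_umul (UScal a) (UScal b)); apply/uea_eqP; constructor.
Qed.

Section Eval.
Variables (A : algType K) (f : {linear g -> A}).
Hypothesis fB : forall x y : g, f (bracket x y) = f x * f y - f y * f x.

Fixpoint ueval t : A :=
  match t with
  | UGen x => f x
  | UScal a => a%:A
  | UAdd t u => ueval t + ueval u
  | UMul t u => ueval t * ueval u
  end.

Lemma ueval_ueq t u : ueq t u -> ueval t = ueval u.
Proof.
elim=> {t u} //=; try by move=> *; congruence.
- by move=> t u v; rewrite addrA.
- by move=> t u; rewrite addrC.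
- by move=> t; rewrite scale0r add0r.
- by move=> t; rewrite -scalerAl mul1r scaleN1r addNr scale0r.
- by move=> t u v; rewrite mulrA.
- by move=> t; rewrite scale1r mul1r.
- by move=> t u v; rewrite mulrDl.
- by move=> t u v; rewrite mulrDr.
- by move=> a b; rewrite scalerDl.
- by move=> a b; rewrite -scalerAl mul1r scalerA.
- by move=> a t; rewrite -scalerAl -scalerAr mul1r mulr1.
- by move=> x y; rewrite linearD.
- by move=> a x; rewrite linearZ /= -scalerAl mul1r.
- by move=> x y; rewrite fB addrC subrK.
Qed.

Definition uea_lift_fun (x : uea) : A := ueval (repr x).

Lemma uea_lift_pi t : uea_lift_fun (\pi_uea t) = ueval t.
Proof. exact/ueval_ueq/ueq_repr. Qed.

End Eval.

Lemma uea_nontrivial : uea_scal 1 != 0.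
Proof.
pose z : {linear g -> K^o} := \0.
have zB (x y : g) : z (bracket x y) = z x * z y - z y * z x.
  by rewrite /= !mulr0 subr0.
apply/eqP => /(congr1 (uea_lift_fun z)).
rewrite /uea_scal [X in _ = _ X](_ : _ = \pi_uea (UScal 0)) //.
rewrite !uea_lift_pi //= scale1r scale0r => /eqP.
by rewrite oner_eq0.
Qed.

HB.instance Definition _ := GRing.Zmodule_isNzRing.Build uea
  uea_mulA uea_mul1l uea_mul1r uea_mulDl uea_mulDr uea_nontrivial.

Definition uea_scale (a : K) (x : uea) : uea := uea_scal a * x.

Lemma uea_scaleA a b x : uea_scale a (uea_scale b x) = uea_scale (a * b) x.
Proof. by rewrite /uea_scale mulrA uea_scalM. Qed.

Lemma uea_scale1 : left_id 1 uea_scale.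
Proof. by move=> x; exact: mul1r. Qed.

Lemma uea_scaleDr : right_distributive uea_scale +%R.
Proof. by move=> a x y; exact: mulrDr. Qed.

Lemma uea_scaleDl x : {morph uea_scale^~ x : a b / a + b}.
Proof. by move=> a b; rewrite /uea_scale uea_scalD mulrDl. Qed.

HB.instance Definition _ := GRing.Zmodule_isLmodule.Build K uea
  uea_scaleA uea_scale1 uea_scaleDr uea_scaleDl.

Lemma uea_scaleAl (a : K) (x y : uea) : a *: (x * y) = (a *: x) * y.
Proof. exact: mulrA. Qed.

HB.instance Definition _ := GRing.Lmodule_isLalgebra.Build K uea uea_scaleAl.

Lemma uea_scaleAr (a : K) (x y : uea) : a *: (x * y) = x * (a *: y).
Proof.
change (uea_scal a * (x * y) = x * (uea_scal a * y)).
by rewrite !mulrA; congr (_ * y); exact: uea_scalC.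
Qed.

HB.instance Definition _ := GRing.Lalgebra_isAlgebra.Build K uea uea_scaleAr.

Definition uea_gen (x : g) : uea := \pi_uea (UGen x).

Lemma uea_gen_linear : linear uea_gen.
Proof.
move=> a x y; transitivity (uea_gen (a *: x) + uea_gen y).
  by rewrite {2}/+%R /= -pi_uadd; apply/uea_eqP; constructor.
congr (_ + _).
change (uea_gen (a *: x) = uea_mul (uea_scal a) (uea_gen x)).
by rewrite -pi_umul; apply/uea_eqP; constructor.
Qed.

HB.instance Definition _ := GRing.isLinear.Build K g uea _ uea_gen uea_gen_linear.

Lemma uea_gen_bracket (x y : g) :
  uea_gen (bracket x y) = uea_gen x * uea_gen y - uea_gen y * uea_gen x.
Proof.
apply/eqP; rewrite eq_sym subr_eq addrC; apply/eqP.
change (uea_mul (uea_gen x) (uea_gen y)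
  = uea_add (uea_mul (uea_gen y) (uea_gen x)) (uea_gen (bracket x y))).
by rewrite -!pi_umul -!pi_uadd; apply/uea_eqP; constructor.
Qed.

Section Lift.
Variables (A : algType K) (f : {linear g -> A}).
Hypothesis fB : forall x y : g, f (bracket x y) = f x * f y - f y * f x.

Definition uea_lift of (forall x y : g, f (bracket x y) = f x * f y - f y * f x) :
  uea -> A := uea_lift_fun f.

Lemma uea_lift_linear : linear (uea_lift fB).
Proof.
move=> a; elim/quotW=> t; elim/quotW=> u; rewrite /uea_lift.
rewrite (_ : a *: _ + _ = \pi_uea (UAdd (UMul (UScal a) t) u)); last first.
  by rewrite pi_uadd pi_umul.
by rewrite !uea_lift_pi //= -scalerAl mul1r.
Qed.

Lemma uea_lift_monoid : monoid_morphism (uea_lift fB).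
Proof.
split; first by rewrite /uea_lift uea_lift_pi //= scale1r.
elim/quotW=> t; elim/quotW=> u; rewrite /uea_lift.
by rewrite (_ : _ * _ = \pi_uea (UMul t u)) ?pi_umul // -?pi_umul !uea_lift_pi.
Qed.

HB.instance Definition _ :=
  GRing.isLinear.Build K uea A _ (uea_lift fB) uea_lift_linear.
HB.instance Definition _ :=
  GRing.isMonoidMorphism.Build uea A (uea_lift fB) uea_lift_monoid.

Lemma uea_lift_gen (x : g) : uea_lift fB (uea_gen x) = f x.
Proof. by rewrite /uea_lift uea_lift_pi. Qed.

Lemma uea_lift_uniq (F : {lrmorphism uea -> A}) :
  (forall x : g, F (uea_gen x) = f x) -> F =1 uea_lift fB.
Proof.
move=> Ff; elim/quotW=> t; rewrite /uea_lift uea_lift_pi //.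
elim: t => [x|a|t IHt u IHu|t IHt u IHu] /=.
- exact: Ff.
- transitivity (F a%:A); last by rewrite linearZ /= rmorph1.
  by congr (F _); rewrite -[RHS]/(uea_scal a * 1) mulr1.
- by rewrite pi_uadd -IHt -IHu -raddfD.
- by rewrite pi_umul -IHt -IHu -rmorphM.
Qed.

End Lift.
End Terms.

Section Functoriality.
Variables (K : fieldType) (g h : lieAlgType K) (phi : lie_hom g h).

Lemma uea_gen_phi_bracket (x y : g) :
  (@uea_gen K h \o phi) (bracket x y) =
  (@uea_gen K h \o phi) x * (@uea_gen K h \o phi) y
    - (@uea_gen K h \o phi) y * (@uea_gen K h \o phi) x.
Proof. by rewrite /= lie_hom_bracket uea_gen_bracket. Qed.

Definition uea_map : {lrmorphism uea g -> uea h} := uea_lift uea_gen_phi_bracket.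

End Functoriality.

Section Restriction.
Variables (R S : pzRingType).

(** The S-module [M] seen as an R-module through [nu]: the argument [nu] is
    only there to key the R-module structure below. *)
Definition restr (nu : {rmorphism R -> S}) (M : lmodType S) : Type := M.

Variable nu : {rmorphism R -> S}.

Section Module.
Variable M : lmodType S.

HB.instance Definition _ := GRing.Zmodule.on (restr nu M).

Definition restr_scale (a : R) (x : restr nu M) : restr nu M := nu a *: (x : M).

Lemma restr_scaleA a b x :
  restr_scale a (restr_scale b x) = restr_scale (a * b) x.
Proof. by rewrite /restr_scale scalerA rmorphM. Qed.

Lemma restr_scale1 : left_id 1 restr_scale.
Proof. by move=> x; rewrite /restr_scale rmorph1 scale1r. Qed.

Lemma restr_scaleDr : right_distributive restr_scale +%R.
Proof. by move=> a x y; exact: scalerDr. Qed.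

Lemma restr_scaleDl x : {morph restr_scale^~ x : a b / a + b}.
Proof. by move=> a b; rewrite /restr_scale rmorphD; exact: scalerDl. Qed.

HB.instance Definition _ := GRing.Zmodule_isLmodule.Build R (restr nu M)
  restr_scaleA restr_scale1 restr_scaleDr restr_scaleDl.

End Module.

Section Map.
Variables (M N : lmodType S) (f : {linear M -> N}).

Definition restr_fun : restr nu M -> restr nu N := f.

Lemma restr_fun_linear : linear restr_fun.
Proof. by move=> a x y; exact: linearP. Qed.

HB.instance Definition _ :=
  GRing.isLinear.Build R (restr nu M) (restr nu N) _ restr_fun restr_fun_linear.

Definition restr_map : {linear restr nu M -> restr nu N} := restr_fun.

End Map.
End Restriction.

Definition projective (R : pzRingType) (P : lmodType R) : Prop :=
  forall (A B : lmodType R) (p : {linear A -> B}) (f : {linear P -> B}),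
    (forall b, exists a, p a = b) ->
    exists f' : {linear P -> A}, forall x, p (f' x) = f x.

Record complex (R : pzRingType) := Complex {
  cx_mod :> nat -> lmodType R;
  cx_d : forall i, {linear cx_mod i.+1 -> cx_mod i};
  cx_dd : forall i x, cx_d i (cx_d i.+1 x) = 0
}.

Record chain_map (R : pzRingType) (P Q : complex R) := ChainMap {
  cm_fun :> forall i, {linear P i -> Q i};
  cm_comm : forall i x, cm_fun i (cx_d P i x) = cx_d Q i (cm_fun i.+1 x)
}.

Definition homotopic (R : pzRingType) (P Q : complex R) (f g : chain_map P Q) :
    Prop :=
  exists s : forall i, {linear P i -> Q i.+1},
    (forall x, f 0%N x - g 0%N x = cx_d Q 0 (s 0%N x)) /\
    (forall i x,
      f i.+1 x - g i.+1 x = cx_d Q i.+1 (s i.+1 x) + s i (cx_d P i x)).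

Record proj_resolution (R : pzRingType) (A : lmodType R) := ProjResolution {
  res_cx :> complex R;
  res_aug : {linear res_cx 0%N -> A};
  res_proj : forall i, projective (res_cx i);
  res_aug_surj : forall a, exists x, res_aug x = a;
  res_exact0 : forall x, res_aug x = 0 <-> exists y, cx_d res_cx 0 y = x;
  res_exactS :
    forall i x, cx_d res_cx i x = 0 <-> exists y, cx_d res_cx i.+1 y = x
}.

Section RestrComplex.
Variables (R S : pzRingType) (nu : {rmorphism R -> S}) (Q : complex S).

Definition restr_cx : complex R :=
  @Complex R (fun i => restr nu (Q i)) (fun i => restr_map nu (cx_d Q i))
    (cx_dd (c := Q)).

End RestrComplex.

(** Cocycles and coboundaries of the cochain complex Hom_R(P, M). *)

Section Hom.
Variables (R : pzRingType) (P : complex R) (M : lmodType R).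

Definition cocycle n (c : {linear P n -> M}) : Prop :=
  forall x, c (cx_d P n x) = 0.

Definition coboundary n : {linear P n -> M} -> Prop :=
  match n with
  | 0%N => fun c => forall x, c x = 0
  | m.+1 => fun c => exists b : {linear P m -> M}, forall x, c x = b (cx_d P m x)
  end.

End Hom.

Section TrivialModule.
Variables (K : fieldType) (g : lieAlgType K).

Let zero : {linear g -> K^o} := \0.

Lemma zero_bracket (x y : g) :
  zero (bracket x y) = zero x * zero y - zero y * zero x.
Proof. by rewrite /= !mulr0 subr0. Qed.

Definition uea_aug : uea g -> K := uea_lift zero_bracket.

HB.instance Definition _ :=
  GRing.RMorphism.copy uea_aug (uea_lift zero_bracket : uea g -> K^o).

Definition triv : lmodType (uea g) := restr uea_aug K^o.

End TrivialModule.

Section CohomologicalDimension.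
Variables (K : fieldType) (g h : lieAlgType K) (phi : lie_hom g h).
Implicit Types (P : proj_resolution (triv g)) (Q : proj_resolution (triv h)).

Definition induced_chain_map P Q (f : chain_map P (restr_cx (uea_map phi) Q)) :
    Prop :=
  forall x : P 0%N, res_aug Q (f 0%N x) = res_aug P x :> K.

(** H^n(g, M) = Ext^n_{U(g)}(K, M) is the cohomology of Hom_{U(g)}(P, M), and
    phi^* sends the class of a cocycle [c] to that of [c \o f n]. Whether phi^*
    is nonzero does not depend on [P], [Q] and [f]. *)
Definition cohomology_map_nonzero (n : nat) (M : lmodType (uea h)) : Prop :=
  forall P Q (f : chain_map P (restr_cx (uea_map phi) Q)),
    induced_chain_map f ->
    exists c : {linear Q n -> M},
      cocycle c /\ ~ coboundary (restr_map (uea_map phi) c \o f n).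

Definition is_cd (n : nat) : Prop :=
  let nonzero_degree m := exists M, cohomology_map_nonzero m M in
  (forall m, nonzero_degree m -> (m <= n)%N) /\
  (forall b, (forall m, nonzero_degree m -> (m <= b)%N) -> (n <= b)%N).

End CohomologicalDimension.

(* Main.v *)
Require Import Defs.
From HB Require Import structures.
From mathcomp Require Import all_boot all_algebra.
From mathcomp Require Import boolp.

Set Implicit Arguments.
Unset Strict Implicit.
Unset Printing Implicit Defensive.

Import GRing.Theory.
Local Open Scope ring_scope.

(** Let B be the image of Q_{n+1} -> Q_n. The corestriction Q_{n+1} -> B is a
    cocycle, and cd(phi) = n makes its pullback along f_{n+1} a coboundary b d
    with b : P_n -> B. Lifting b to s_n : P_n -> Q_{n+1} gives
    d s_n d = d f_{n+1}, so that s_n extends, with zeros below degree n and by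
    acyclicity above it, to a homotopy s with f = d s + s d in all degrees > n.
    Subtracting d s + s d from f gives psi. *)

Section Image.
Variables (R : pzRingType) (A B : lmodType R) (p : {linear A -> B}).

Definition im_pred : pred B := fun b => `[< exists a, p a = b >].

Lemma im_pred_submod_closed : submod_closed im_pred.
Proof.
split; first by apply/asboolP; exists 0; rewrite linear0.
move=> k _ _ /asboolP[a <-] /asboolP[b <-].
by apply/asboolP; exists (k *: a + b); rewrite linearP.
Qed.

HB.instance Definition _ := GRing.isSubmodClosed.Build R B im_pred
  im_pred_submod_closed.

(** The image is made a module in its own right because it becomes the coefficient module to which
    the hypothesis on the cohomological dimension is applied. *)
Definition im_mod : Type := {b : B | im_pred b}.
HB.instance Definition _ := SubType.on im_mod.
HB.instance Definition _ := Choice.on im_mod.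
HB.instance Definition _ := [SubChoice_isSubLmodule of im_mod by <:].

Section Factor.
Variables (C : lmodType R) (f : {linear C -> B}).
Hypothesis f_im : forall x, exists a, p a = f x.

Definition to_im (x : C) : im_mod := exist _ (f x) (asboolT (f_im x)).

Lemma to_im_linear : linear to_im.
Proof. by move=> k x y; apply: val_inj; rewrite linearP /= linearP. Qed.

HB.instance Definition _ := GRing.isLinear.Build R C im_mod _ to_im to_im_linear.

End Factor.

Definition corestr : {linear A -> im_mod} :=
  @to_im A p (fun x => ex_intro _ x erefl).

Lemma corestrE x : val (corestr x) = p x. Proof. by []. Qed.

Lemma corestr_surj (b : im_mod) : exists a, corestr a = b.
Proof. by case: b => b pb; have /asboolP[a ab] := pb; exists a; apply: val_inj. Qed.

(** [projective] only lifts along maps onto the whole codomain; corestricting [p] to its image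
    supplies such a map. *)
Lemma projective_lift (P : lmodType R) (f : {linear P -> B}) :
    projective P -> (forall x, exists a, p a = f x) ->
  exists f' : {linear P -> A}, forall x, p (f' x) = f x.
Proof.
move=> projP f_im; have [f' f'E] := projP _ _ corestr (to_im f_im) corestr_surj.
by exists f' => x; rewrite -corestrE f'E.
Qed.

End Image.

(** [I] is what the next choice needs; packing it into a sigma type lets the recursion carry it
    along. *)
Lemma dependent_choice_nat (T : nat -> Type) (I : forall i, T i -> Prop)
    (r : forall i, T i -> T i.+1 -> Prop) (t0 : T 0) :
    I 0 t0 -> (forall i t, I i t -> exists t', I i.+1 t' /\ r i t t') ->
  exists s : forall i, T i, [/\ s 0 = t0, forall i, I i (s i)
    & forall i, r i (s i) (s i.+1)].
Proof.
move=> It0 step.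
pose next i (t : {t | I i t}) : {t' | I i.+1 t' /\ r i (sval t) t'} :=
  cid (step i (sval t) (svalP t)).
pose s := fix s i : {t | I i t} :=
  if i is j.+1 then exist _ (sval (next j (s j))) (svalP (next j (s j))).1
  else exist _ t0 It0.
exists (fun i => sval (s i)); split=> // i; first exact: svalP.
exact: (svalP (next i (s i))).2.
Qed.

(** Nothing is asked in degree 0, where a resolution stripped of its augmentation has the resolved
    module as homology. *)
Definition acyclic (R : pzRingType) (C : complex R) :=
  forall i (x : C i.+1), cx_d C i x = 0 -> exists y, cx_d C i.+1 y = x.

Section Homotopy.
Variables (R : pzRingType) (P C : complex R).

Section Extension.
Hypotheses (projP : forall i, projective (P i)) (acC : acyclic C).
Variables (u : forall i, {linear P i -> C i}).
Hypothesis u_comm : forall i x, u i (cx_d P i x) = cx_d C i (u i.+1 x).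

(** From degree n on, u_{i+1} - s_i d takes values in cycles because d s_i d = d u_{i+1}. Acyclicity
    and projectivity lift it to s_{i+1}, and then d s_{i+1} d = u_{i+1} d = d u_{i+2}, so the
    construction continues. *)
Lemma homotopy_extension n (t : {linear P n -> C n.+1}) :
    (forall x, cx_d C n (t (cx_d P n x)) = cx_d C n (u n.+1 x)) ->
  exists s : forall i, {linear P i -> C i.+1},
    s n = t /\
    forall i, (n <= i)%N ->
      forall x, u i.+1 x = cx_d C i.+1 (s i.+1 x) + s i (cx_d P i x).
Proof.
move=> tP.
(* The recursion starts in degree 0, so [I] imposes [t] on reaching degree n, up to a transport of
   types, and asks nothing below. *)
pose I i (v : {linear P i -> C i.+1}) :=
  (forall e : n = i, v = ecast i {linear P i -> C i.+1} e t) /\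
  ((n <= i)%N -> forall x, cx_d C i (v (cx_d P i x)) = cx_d C i (u i.+1 x)).
pose r i (v : {linear P i -> C i.+1}) (w : {linear P i.+1 -> C i.+2}) :=
  (n <= i)%N -> forall x, u i.+1 x = cx_d C i.+1 (w x) + v (cx_d P i x).
(* At i = n the transport is the identity, as equality proofs on [nat] are unique; below n, zero
   will do. *)
have I_le i : (i <= n)%N -> exists v, I i v.
  rewrite leq_eqVlt => /predU1P[-> | lt_in].
    by exists t; split=> // e; rewrite eq_axiomK.
  exists \0; split=> [e | le_ni]; first by rewrite e ltnn in lt_in.
  by rewrite ltnNge le_ni in lt_in.
have [t0 It0] := I_le 0 (leq0n n).
have [i v Iv | s [_ Is rs]] := dependent_choice_nat (r := r) It0.
  have [le_ni | lt_in] := leqP n i; last first.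
    have [w Iw] := I_le i.+1 lt_in.
    by exists w; split=> // le_ni; rewrite ltnNge le_ni in lt_in.
  have [|w wE] := projective_lift (p := cx_d C i.+1)
      (f := u i.+1 \- (v \o cx_d P i)) (@projP i.+1).
    by move=> x; apply: acC; rewrite linearB /= Iv.2 // subrr.
  exists w; split=> [|_ x]; last by rewrite wE /= subrK.
  split=> [e | _ x]; first by rewrite e ltnn in le_ni.
  by rewrite wE /= cx_dd linear0 subr0 u_comm.
exists s; split=> [|i le_ni]; first by have := (Is n).1 erefl.
exact: rs.
Qed.

End Extension.

(** This is [homotopy_extension] with n = 0 for f - g, started at a lift of f_0 - g_0 through the
    differential. *)
Lemma homotopic_of_zero_augmentation (f g : chain_map P C) :
    (forall i, projective (P i)) -> acyclic C ->
    (forall x, exists y, cx_d C 0 y = f 0 x - g 0 x) ->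
  homotopic f g.
Proof.
move=> projP acC fg.
have [t tE] := projective_lift (p := cx_d C 0) (f := f 0 \- g 0) (projP 0) fg.
pose u i : {linear P i -> C i} := f i \- g i.
have u_comm i x : u i (cx_d P i x) = cx_d C i (u i.+1 x).
  by rewrite /= linearB /= !cm_comm.
have [|s [s0 sP]] := homotopy_extension projP acC u_comm (t := t).
  by move=> x; rewrite tE -u_comm.
exists s; split=> [x | i x]; first by rewrite s0 tE.
exact: sP.
Qed.

Section Deform.
Variables (f : chain_map P C) (s : forall i, {linear P i -> C i.+1}).

Definition deform_fun i : {linear P i -> C i} :=
  match i with
  | 0 => f 0 \- (cx_d C 0 \o s 0)
  | j.+1 => f j.+1 \- ((cx_d C j.+1 \o s j.+1) \+ (s j \o cx_d P j))
  end.

Lemma deform_comm i x : deform_fun i (cx_d P i x) = cx_d C i (deform_fun i.+1 x).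
Proof.
by case: i x => [|i] x;
  rewrite /= linearB ?linearD /= !cx_dd ?linear0 ?add0r ?addr0 cm_comm.
Qed.

Definition deform : chain_map P C := ChainMap deform_comm.

Lemma homotopic_deform : homotopic f deform.
Proof. by exists s; split=> [x | i x]; rewrite /= subKr. Qed.

End Deform.
End Homotopy.

(** Lifting goes degree by degree; the invariant [I], that v d lands in boundaries, is exactly what
    the next lift needs. *)
Lemma comparison (R : pzRingType) (A : lmodType R) (P P' : proj_resolution A) :
  exists f : chain_map P P', forall x, res_aug P' (f 0 x) = res_aug P x.
Proof.
have res_aug_d (Q : proj_resolution A) y : res_aug Q (cx_d Q 0 y) = 0.
  by apply/res_exact0; exists y.
have [|f0 f0E] := projective_lift (p := res_aug P') (f := res_aug P) (@res_proj _ _ P 0).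
  by move=> x; exact: res_aug_surj.
pose I i (v : {linear P i -> P' i}) :=
  forall x, exists y, cx_d P' i y = v (cx_d P i x).
pose r i (v : {linear P i -> P' i}) (w : {linear P i.+1 -> P' i.+1}) :=
  forall x, v (cx_d P i x) = cx_d P' i (w x).
have If0 : I 0 f0 by move=> x; apply/res_exact0; rewrite f0E res_aug_d.
have [i v Iv | f [f_0 _ f_comm]] := dependent_choice_nat (r := r) If0.
  have [w wE] := projective_lift (f := v \o cx_d P i) (@res_proj _ _ P i.+1) Iv.
  exists w; split=> x; last by rewrite wE.
  by apply/res_exactS; rewrite wE /= cx_dd linear0.
by exists (ChainMap f_comm) => x /=; rewrite f_0.
Qed.

Section Pullback.
Variables (K : fieldType) (g h : lieAlgType K) (phi : lie_hom g h).
Let nu := uea_map phi.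
Implicit Types (P : proj_resolution (triv g)) (Q : proj_resolution (triv h)).

Lemma restr_acyclic Q : acyclic (restr_cx nu Q).
Proof. by move=> i x; exact: (res_exactS x).1. Qed.

Section CompositeThroughResolutions.
Variables (P P' : proj_resolution (triv g)) (Q Q' : proj_resolution (triv h)).
Variables (a : chain_map P P') (f : chain_map P' (restr_cx nu Q')).
Variables (b : chain_map Q' Q).

Definition comp3_fun i : {linear P i -> restr_cx nu Q i} :=
  restr_map nu (b i) \o (f i \o a i).

Lemma comp3_comm i x :
  comp3_fun i (cx_d P i x) = cx_d (restr_cx nu Q) i (comp3_fun i.+1 x).
Proof. by rewrite /= cm_comm cm_comm; exact: cm_comm. Qed.

Definition comp3 : chain_map P (restr_cx nu Q) := ChainMap comp3_comm.

End CompositeThroughResolutions.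

(** Both maps agree after augmentation, so exactness of Q puts the values of f_0 - f'_0 among the
    boundaries. *)
Lemma induced_homotopic P Q (f f' : chain_map P (restr_cx nu Q)) :
  induced_chain_map f -> induced_chain_map f' -> homotopic f f'.
Proof.
move=> fE f'E; apply: homotopic_of_zero_augmentation.
- exact: res_proj.
- exact: restr_acyclic.
- move=> x; apply: (res_exact0 (p := Q) _).1.
  rewrite (raddfB (res_aug Q)); apply/eqP; rewrite subr_eq0; apply/eqP.
  exact: etrans (fE x) (esym (f'E x)).
Qed.

(** The hypothesis only provides some resolutions P', Q' and some f' on which
    cocycles pull back to coboundaries; comparing them with P, Q and f, which is
    homotopic to the composite P -> P' -> Q' -> Q, gives the claim for f. *)
Lemma coboundary_pullback m (M : lmodType (uea h)) P Q
    (f : chain_map P (restr_cx nu Q)) (c : {linear Q m -> M}) :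
    ~ cohomology_map_nonzero phi m M -> induced_chain_map f -> cocycle c ->
  coboundary (restr_map nu c \o f m).
Proof.
move=> /existsNP[P' /existsNP[Q' /existsNP[f' /not_implyP[f'E zero]]]] fE cc.
have [a aE] := comparison P P'; have [b bE] := comparison Q' Q.
pose c' : {linear Q' m -> M} := c \o b m.
have cc' : cocycle c' by move=> x; rewrite /c' /= cm_comm cc.
have bd : coboundary (restr_map nu c' \o f' m).
  by apply: contrapT => nbd; apply: zero; exists c'.
have [|s [s0 sS]] := @induced_homotopic _ _ f (comp3 a f' b) fE.
  by move=> x; exact: etrans (bE _) (etrans (f'E _) (aE x)).
(* The first term is a coboundary pulled back along [a]. As [c] kills boundaries, the homotopy
   reduces the second to c s_{m-1} d, or to 0 if m = 0. *)
have cE x : c (f m x) = c' (f' m (a m x)) + c (f m x - comp3 a f' b m x).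
  by rewrite linearB addrC subrK.
clear zero; case: m c cc @c' cc' bd cE => [|m] c cc c' cc'.
  by move=> bd cE x; rewrite /= cE s0 cc addr0; exact: bd.
move=> [e eE] cE; exists (e \o a m \+ (restr_map nu c \o s m)) => x.
rewrite /= cE sS linearD cc add0r; congr (_ + _).
by rewrite cm_comm; exact: eE.
Qed.

End Pullback.

Theorem theorem4p5 (K : fieldType) (g h : lieAlgType K) (phi : lie_hom g h)
    (n : nat) (cd_phi : is_cd phi n)
    (P : proj_resolution (triv g)) (Q : proj_resolution (triv h))
    (f : chain_map P (restr_cx (uea_map phi) Q))
    (f_phi : induced_chain_map f) :
  exists psi : chain_map P (restr_cx (uea_map phi) Q),
    homotopic f psi /\
    forall i : nat, (n < i)%N -> forall x : P i, psi i x = 0.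
Proof.
have zero : ~ cohomology_map_nonzero phi n.+1 (im_mod (cx_d Q n)).
  by move=> nz; have := cd_phi.1 n.+1 (ex_intro _ _ nz); rewrite ltnn.
have cc : cocycle (corestr (cx_d Q n)).
  by move=> x; apply: val_inj; rewrite corestrE cx_dd.
have [e eE] := coboundary_pullback zero f_phi cc.
have [b|t tE] := @res_proj _ _ P n _ _ (restr_map (uea_map phi) (corestr (cx_d Q n))) e.
  exact: corestr_surj (b : im_mod (cx_d Q n)).
(* Read in Q_n through [val], the equation e d = corestr f_{n+1} becomes d t d = d f_{n+1}. *)
have [|s [_ sP]] := homotopy_extension (@res_proj _ _ P) (@restr_acyclic _ _ _ _ Q)
    (cm_comm f) (t := t).
  by move=> x; exact: (congr1 val (etrans (tE _) (esym (eE x)))).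
exists (deform f s); split; first exact: homotopic_deform.
(* Degree 0 is excluded by n < 0 being false; in degree i+1 the bound gives n <= i, the range of
   [sP]. *)
by case=> // i lt_ni x; rewrite /= sP // subrr.
Qed.
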